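(* Let $L \in \mathbb{R}^{N\times N}$ be the Laplacian matrix of a connected graph with $N$ nodes, and let $(\alpha_k)_{k \in \mathbb{N}}$ be a real sequence such that $0 < \alpha_k \le \alpha^{\max} < \infty$ for all $k \in \mathbb{N}$, for some $\alpha^{\max}$, with $\lim_{k\to\infty}\alpha_k = 0$ and $\sum_{k=0}^\infty \alpha_k = \infty$. Then the system $$\boldsymbol{x}(k+1) = \boldsymbol{x}(k) - \alpha_k L\, \boldsymbol{x}(k), \quad k \in \mathbb{N},$$ asymptotically reaches consensus, i.e., for every $\boldsymbol{x}(0) \in \mathbb{R}^N$ the solution $\boldsymbol{x}(k)$ converges to $\overline{x}\,\boldsymbol{1}_N$ for some $\overline{x} \in \mathbb{R}$.
   Context: $\boldsymbol{1}_N \in \mathbb{R}^N$ is the vector with all entries equal to $1$. The graph has nonnegative edge weights $a_{i,j}$ collected in the adjacency matrix $W = [a_{i,j}] \in \mathbb{R}^{N\times N}$, with an edge from $i$ to $j$ when $a_{i,j}>0$, and may be directed; its Laplacian is $L = D_{\mathrm{out}} - W$, where $D_{\mathrm{out}}$ is the diagonal matrix with $i$-th diagonal entry $\sum_j a_{i,j}$. Connected means that every node can be reached from every other node along (directed) edges; for undirected graphs ($W$ symmetric) this is the usual connectedness. *)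

(* Defs.v *)
(* MathComp / MathComp-Analysis *)
From HB Require Import structures.
From mathcomp Require Import all_boot all_order all_algebra.
From mathcomp Require Import all_classical all_reals all_analysis.
Set Implicit Arguments.
Unset Strict Implicit.
Unset Printing Implicit Defensive.
Import Order.TTheory GRing.Theory Num.Theory.
Import numFieldNormedType.Exports.
Local Open Scope classical_set_scope.
Local Open Scope ring_scope.

(* A weighted directed graph on 'I_N is given by its adjacency matrix W.
   Self-loops are not excluded: they cancel in the Laplacian. *)
Definition edge_weights (R : realType) (N : nat) (W : 'M[R]_N) : Prop :=
  forall i j : 'I_N, 0 <= W i j.

Definition edge (R : realType) (N : nat) (W : 'M[R]_N) : rel 'I_N :=
  fun i j => 0 < W i j.

(* Along directed edges, so this is strong connectedness; it is the usual
   connectedness when W is symmetric. *)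
Definition connected_graph (R : realType) (N : nat) (W : 'M[R]_N) : Prop :=
  forall i j : 'I_N, connect (edge W) i j.

Definition out_degree (R : realType) (N : nat) (W : 'M[R]_N) : 'M[R]_N :=
  diag_mx (\row_(i < N) \sum_(j < N) W i j).

Definition laplacian (R : realType) (N : nat) (W : 'M[R]_N) : 'M[R]_N :=
  out_degree W - W.

Definition ones (R : realType) (N : nat) : 'cV[R]_N := const_mx 1.

(* The system x(k+1) = f k (x(k)): the initial state x 0 is arbitrary, and
   the limit value xbar may depend on it. *)
Definition reaches_consensus (R : realType) (N : nat)
    (f : nat -> 'cV[R]_N -> 'cV[R]_N) : Prop :=
  forall x : nat -> 'cV[R]_N,
    (forall k : nat, x k.+1 = f k (x k)) ->
    exists xbar : R, x k @[k --> \oo] --> xbar *: ones R N.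

(* Main.v *)
(* Strong connectedness gives a positive left null vector p of L.  The p-weighted
   mean of x(k) is conserved; let y be the deviation from it, V = sum_i p_i y_i^2
   and E = sum_ij p_i a_ij (y_i - y_j)^2.  Since 2 <p y, L y> = E and, by
   Cauchy-Schwarz, sum_i p_i (L y)_i^2 <= D E with D = sum_ij a_ij, one gets
   V(k+1) <= V(k) - alpha_k (1 - alpha_k D) E(k).  Chaining along paths yields a
   Poincare inequality V <= C E, so eventually
   V(k+1) <= V(k) - alpha_k V(k) / (2 C), and the divergence of sum alpha_k
   forces V(k) -> 0. *)
Require Import Defs.
From HB Require Import structures.
From mathcomp Require Import all_boot all_order all_algebra.
From mathcomp Require Import all_classical all_reals all_analysis.
From mathcomp Require Import ring lra.
Import Order.TTheory GRing.Theory Num.Theory.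
Import numFieldNormedType.Exports.
Local Open Scope classical_set_scope.
Local Open Scope ring_scope.

(** * Left null vectors of the Laplacian *)

Lemma laplacian_mulmxE {R : realType} {N : nat} (W : 'M[R]_N) (x : 'cV[R]_N) (i : 'I_N) :
  (laplacian W *m x) i 0 = \sum_j W i j * (x i 0 - x j 0).
Proof.
rewrite /laplacian /out_degree mulmxBl mul_diag_mx !mxE mulr_suml -sumrB.
by apply: eq_bigr => j _; rewrite mulrBr.
Qed.

Lemma mulmx_laplacianE {R : realType} {N : nat} (W : 'M[R]_N) (u : 'rV[R]_N) (j : 'I_N) :
  (u *m laplacian W) 0 j = u 0 j * (\sum_i W j i) - \sum_i u 0 i * W i j.
Proof. by rewrite /laplacian /out_degree mulmxBr mul_mx_diag !mxE. Qed.

(* The left null vectors of the Laplacian, written entrywise. *)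
Definition stationary {R : realType} {N : nat} (W : 'M[R]_N) (p : 'I_N -> R) : Prop :=
  forall j, \sum_i p i * W i j = p j * \sum_i W j i.

(** The Laplacian kills the all-ones vector, nonzero in size [N.+1], so its determinant vanishes and
    it has a nonzero left null vector too. *)
Lemma stationary_exists {R : realType} {N : nat} (W : 'M[R]_N.+1) :
  exists2 u : 'I_N.+1 -> R, stationary W u & exists i, u i != 0.
Proof.
have ones_neq0 : (ones R N.+1)^T != 0.
  apply/eqP => /matrixP/(_ 0 0); rewrite !mxE => /eqP; exact/negP/oner_neq0.
have ones_ker : (ones R N.+1)^T *m (laplacian W)^T = 0.
  rewrite -trmx_mul; apply/matrixP => i j; rewrite mxE ord1 laplacian_mulmxE.
  by rewrite big1 ?mxE // => k _; rewrite !mxE subrr mulr0.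
have : \det (laplacian W) == 0.
  by rewrite -det_tr; apply/det0P; exists (ones R N.+1)^T.
case/det0P => u u_neq0 uL; exists (fun i => u 0 i).
  by move=> j; have /rowP/(_ j) := uL; rewrite mulmx_laplacianE mxE => /subr0_eq.
have /rV0Pn[i ui] := u_neq0.
by exists i.
Qed.

(** The sum is p L f, and p L = 0. Taking f = x(k) gives conservation of the mean, f = y^2 the
    energy identity. *)
Lemma stationary_sum_diff0 {R : realType} {N : nat} (W : 'M[R]_N) (p f : 'I_N -> R) :
  stationary W p -> \sum_i p i * (\sum_j W i j * (f i - f j)) = 0.
Proof.
move=> pS.
transitivity (\sum_i \sum_j (p i * W i j * f i - p i * W i j * f j)).
  by apply: eq_bigr => i _; rewrite mulr_sumr; apply: eq_bigr => j _; ring.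
under eq_bigr => i _ do rewrite sumrB.
rewrite sumrB [X in _ - X]exchange_big /= -sumrB big1 // => i _.
by rewrite -!mulr_suml pS mulr_sumr subrr.
Qed.

(* The triangle inequality makes [|u|] sub-stationary, and the defects add up to zero. *)
Lemma stationary_norm {R : realType} {N : nat} (W : 'M[R]_N) (W_ge0 : edge_weights W)
    (u : 'I_N -> R) : stationary W u -> stationary W (fun i => `|u i|).
Proof.
move=> uS.
have le_flux j : `|u j| * (\sum_i W j i) <= \sum_i `|u i| * W i j.
  rewrite -[X in _ * X]ger0_norm ?sumr_ge0 // -normrM -uS.
  apply: le_trans (ler_norm_sum _ _ _) _.
  by apply: ler_sum => i _; rewrite normrM (ger0_norm (W_ge0 _ _)).
have defect0 : \sum_j (\sum_i `|u i| * W i j - `|u j| * \sum_i W j i) = 0.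
  rewrite sumrB exchange_big /= -sumrB big1 // => i _.
  by rewrite mulr_sumr subrr.
move=> j; apply/eqP; rewrite -subr_eq0; apply/eqP.
by apply: (psumr_eq0P _ defect0) => // i _; rewrite subr_ge0.
Qed.

Lemma connect_closed {T : finType} (e : rel T) (P : T -> Prop) (x y : T) :
  (forall x y, P x -> e x y -> P y) -> P x -> connect e x y -> P y.
Proof.
move=> Pe Px /connectP[s]; elim: s x Px => [|z s IH] x Px /=; first by move=> _ ->.
by case/andP => exz; apply: IH; apply: Pe exz.
Qed.

(** Positivity of [|u|] spreads along edges: an edge from [i] to [k] with [|u i| > 0] makes the
    inflow at [k] positive, and stationarity equates it with [|u k|] times the out-degree of [k]. *)
Lemma positive_stationary {R : realType} {N : nat} (W : 'M[R]_N.+1)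
    (W_ge0 : edge_weights W) (W_conn : connected_graph W) :
  exists2 p : 'I_N.+1 -> R, stationary W p & forall i, 0 < p i.
Proof.
have [u uS [i0 ui0]] := stationary_exists W.
exists (fun i => `|u i|); first exact: stationary_norm.
move=> j; apply: (connect_closed _ (fun k => 0 < `|u k|) _ _ _ _ (W_conn i0 j)) => [i k ui Wik|];
  last by rewrite normr_gt0.
have flux_gt0 : 0 < `|u k| * \sum_i W k i.
  rewrite -(stationary_norm _ W_ge0 _ uS k) (bigD1 i) //= ltr_wpDr ?mulr_gt0 //.
  by apply: sumr_ge0 => l _; rewrite mulr_ge0.
by rewrite lt0r normr_ge0 andbT; apply: contraTneq flux_gt0 => ->; rewrite mul0r ltxx.
Qed.

(** * Cauchy-Schwarz and the Dirichlet form *)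

(** Lagrange's identity. It yields Cauchy-Schwarz and, for mean zero, turns a weighted sum of
    squares into pairwise differences. *)
Lemma sum_sqr_diff {R : realType} {I : finType} (a t : I -> R) :
  \sum_i \sum_j a i * a j * (t i - t j) ^+ 2
  = 2 * ((\sum_i a i) * (\sum_i a i * t i ^+ 2) - (\sum_i a i * t i) ^+ 2).
Proof.
set A := \sum_i a i; set S := \sum_i a i * t i; set Q := \sum_i a i * t i ^+ 2.
transitivity (\sum_i (a i * t i ^+ 2 * A - 2 * (a i * t i * S) + a i * Q)).
  apply: eq_bigr => i _; rewrite !mulr_sumr -sumrB -big_split /=.
  by apply: eq_bigr => j _; ring.
rewrite big_split sumrB /= -mulr_sumr -!mulr_suml -/A -/S -/Q; ring.
Qed.

Lemma sum_sqr_le {R : realType} {I : finType} (a t : I -> R) : (forall i, 0 <= a i) ->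
  (\sum_i a i * t i) ^+ 2 <= (\sum_i a i) * \sum_i a i * t i ^+ 2.
Proof.
move=> a_ge0; rewrite -subr_ge0 -(pmulr_rge0 _ (ltr0n R 2)) -sum_sqr_diff.
by do 2!apply: sumr_ge0 => ? _; rewrite mulr_ge0 ?sqr_ge0 ?mulr_ge0.
Qed.

Definition dirichlet {R : realType} {N : nat} (W : 'M[R]_N) (p y : 'I_N -> R) : R :=
  \sum_i \sum_j p i * W i j * (y i - y j) ^+ 2.

Section Dirichlet.
Context {R : realType} {N : nat} (W : 'M[R]_N) (p : 'I_N -> R)
  (W_ge0 : edge_weights W) (p_ge0 : forall i, 0 <= p i).

Lemma dirichlet_term_ge0 (y : 'I_N -> R) (i j : 'I_N) :
  0 <= p i * W i j * (y i - y j) ^+ 2.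
Proof. by rewrite mulr_ge0 ?sqr_ge0 ?mulr_ge0. Qed.

Lemma dirichlet_ge0 (y : 'I_N -> R) : 0 <= dirichlet W p y.
Proof. by do 2!apply: sumr_ge0 => ? _; apply: dirichlet_term_ge0. Qed.

(** Since 2 y_i (y_i - y_j) = (y_i - y_j)^2 + (y_i^2 - y_j^2), the two sides differ by a sum that
    stationarity cancels. *)
Lemma dirichlet_laplacian (y : 'I_N -> R) : stationary W p ->
  2 * \sum_i p i * y i * (\sum_j W i j * (y i - y j)) = dirichlet W p y.
Proof.
move=> pS; apply/eqP; rewrite -subr_eq0; apply/eqP.
apply: etrans (stationary_sum_diff0 W p (fun i => y i ^+ 2) pS).
rewrite mulr_sumr /dirichlet -sumrB; apply: eq_bigr => i _.
by rewrite !mulr_sumr -sumrB; apply: eq_bigr => j _; ring.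
Qed.

(** Cauchy-Schwarz in each row with weights [W i j]; each row sum is then bounded by the total
    weight. *)
Lemma sqr_laplacian_le (y : 'I_N -> R) :
  \sum_i p i * (\sum_j W i j * (y i - y j)) ^+ 2
  <= (\sum_i \sum_j W i j) * dirichlet W p y.
Proof.
rewrite /dirichlet mulr_sumr; apply: ler_sum => i _.
apply: le_trans (ler_wpM2l (p_ge0 i) (sum_sqr_le _ _ (W_ge0 i))) _.
rewrite mulrCA; under [X in _ <= _ * X]eq_bigr => j _ do rewrite -mulrA.
rewrite -mulr_sumr ler_wpM2r //.
  by rewrite mulr_ge0 // sumr_ge0 // => j _; rewrite mulr_ge0 ?sqr_ge0.
rewrite [leRHS](bigD1 i) //= lerDl; apply: sumr_ge0 => k _.
by apply: sumr_ge0.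
Qed.

End Dirichlet.

(** * Poincare inequality *)

Section Poincare.
Context {R : realType} {N : nat} (W : 'M[R]_N) (p : 'I_N -> R)
  (W_ge0 : edge_weights W) (p_gt0 : forall i, 0 < p i).
Let p_ge0 i : 0 <= p i := ltW (p_gt0 i).

(** Induction along a path from [i]: the squared difference across a new edge is controlled by a
    single term of the Dirichlet form. *)
Lemma sqr_diff_le_dirichlet (W_conn : connected_graph W) (i j : 'I_N) :
  exists2 C : R, 0 <= C & forall y, (y i - y j) ^+ 2 <= C * dirichlet W p y.
Proof.
apply: (connect_closed _ (fun j => exists2 C : R, 0 <= C &
    forall y, (y i - y j) ^+ 2 <= C * dirichlet W p y) _ _ _ _ (W_conn i j)); last first.
  by exists 0 => // y; rewrite subrr expr0n mul0r.
move=> k l [C C_ge0 leC] Wkl.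
have c_gt0 : 0 < p k * W k l by rewrite mulr_gt0.
exists (2 * (C + (p k * W k l)^-1)) => [|y].
  by rewrite mulr_ge0 // addr_ge0 // invr_ge0 ltW.
have le_kl : (y k - y l) ^+ 2 <= (p k * W k l)^-1 * dirichlet W p y.
  rewrite ler_pdivlMl // /dirichlet (bigD1 k) //= (bigD1 l) //= -addrA lerDl.
  by rewrite addr_ge0 ?sumr_ge0 // => m _; rewrite ?sumr_ge0 // => *; apply: dirichlet_term_ge0.
(* With a = y i - y k and b = y k - y l, (a - b)^2 >= 0 gives (a + b)^2 <= 2 a^2 + 2 b^2. *)
have := leC y; have := sqr_ge0 ((y i - y k) - (y k - y l)).
rewrite -mulrA mulrDl; nra.
Qed.

End Poincare.

Lemma poincare {R : realType} {N : nat} (W : 'M[R]_N.+1) (p : 'I_N.+1 -> R)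
    (W_ge0 : edge_weights W) (W_conn : connected_graph W) (p_gt0 : forall i, 0 < p i) :
  exists2 C : R, 0 < C & forall y, \sum_i p i * y i = 0 ->
    \sum_i p i * y i ^+ 2 <= C * dirichlet W p y.
Proof.
have p_ge0 i : 0 <= p i := ltW (p_gt0 i).
have /choice[C HC] (ij : 'I_N.+1 * 'I_N.+1) : exists c : R,
    0 <= c /\ forall y, (y ij.1 - y ij.2) ^+ 2 <= c * dirichlet W p y.
  by have [c c_ge0 cP] := sqr_diff_le_dirichlet W p W_ge0 p_gt0 W_conn ij.1 ij.2; exists c.
set P := \sum_i p i; set K := \sum_i \sum_j p i * p j * C (i, j).
have P_gt0 : 0 < P by rewrite /P big_ord_recl ltr_pwDl ?sumr_ge0.
have K_ge0 : 0 <= K.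
  by do 2!apply: sumr_ge0 => ? _; rewrite !mulr_ge0 // (HC _).1.
(* [K] is only known to be nonnegative; the summand 1 makes the constant positive. *)
exists (1 + (2 * P)^-1 * K) => [|y y0].
  by rewrite ltr_pwDl // mulr_ge0 // invr_ge0 mulr_ge0 // ltW.
have E_ge0 := dirichlet_ge0 W p W_ge0 p_ge0 y.
suff le_K : 2 * P * (\sum_i p i * y i ^+ 2) <= K * dirichlet W p y.
  rewrite mulrDl mul1r ler_wpDl // -mulrA ler_pdivlMl // ?mulr_gt0 //.
have -> : 2 * P * (\sum_i p i * y i ^+ 2) = \sum_i \sum_j p i * p j * (y i - y j) ^+ 2.
  by rewrite sum_sqr_diff y0 expr0n subr0 mulrA.
rewrite /K mulr_suml; apply: ler_sum => i _; rewrite mulr_suml; apply: ler_sum => j _.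
by rewrite -[leRHS]mulrA ler_wpM2l ?mulr_ge0 //; apply: (HC (i, j)).2.
Qed.

(** * Convergence *)

(** From [K] on [V] is nonincreasing, so it suffices that it falls below each e once. Otherwise
    every step loses at least c e alpha_k, and divergence of the sum would drive [V] below zero. *)
Lemma cvg0_of_descent {R : realType} (c : R) (alpha V : nat -> R) (K : nat) :
  0 < c -> (forall k, 0 <= alpha k) -> (forall k, 0 <= V k) ->
  (forall k, (K <= k)%N -> V k.+1 <= V k - c * alpha k * V k) ->
  \sum_(0 <= k < n) alpha k @[n --> \oo] --> +oo ->
  V k @[k --> \oo] --> (0 : R).
Proof.
move=> c_gt0 alpha_ge0 V_ge0 descent alpha_sum.
have V_dec k n : (K <= k)%N -> V (k + n)%N <= V k.
  move=> leKk; elim: n => [|n IH]; first by rewrite addn0.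
  rewrite addnS; apply: le_trans (descent _ _) _; first by rewrite (leq_trans leKk) ?leq_addr.
  by apply: le_trans IH; rewrite gerBl !mulr_ge0 // ltW.
apply/cvgrPdist_lt => e e_gt0.
have [k leKk Vk] : exists2 k, (K <= k)%N & V k < e.
  apply: contrapT => noV.
  have V_ge k : (K <= k)%N -> e <= V k.
    by move=> leKk; rewrite leNgt; apply/negP => Vk; apply: noV; exists k.
  have V_le n : V (K + n)%N <= V K - c * e * \sum_(K <= k < K + n) alpha k.
    elim: n => [|n IH]; first by rewrite addn0 big_geq // mulr0 subr0.
    rewrite addnS big_nat_recr ?leq_addr //=.
    have := descent _ (leq_addr n K); have := V_ge _ (leq_addr n K).
    have ca_ge0 : 0 <= c * alpha (K + n)%N by rewrite mulr_ge0 // ltW.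
    move/(ler_wpM2l ca_ge0); lra.
  (* Removing the head before [K] leaves a sum of at least (V K + 1) / (c e), which forces a value
     of [V] at most -1. *)
  have [n _ big_n] : \forall n \near \oo,
      (V K + 1) / (c * e) + \sum_(0 <= k < K) alpha k <= \sum_(0 <= k < n) alpha k.
    by move/cvgryPge: alpha_sum; apply.
  have := big_n (K + n)%N (leq_addl _ _).
  rewrite /= (@big_cat_nat _ _ _ K 0 (K + n)%N) ?leq_addr //= [leRHS]addrC lerD2r.
  rewrite ler_pdivrMr ?mulr_gt0 // mulrC.
  have := V_le n; have := V_ge0 (K + n)%N; lra.
exists k => // n /= lekn; rewrite sub0r normrN ger0_norm //.
by rewrite -(subnKC lekn) (le_lt_trans (V_dec _ _ leKk)).
Qed.

Lemma cvg_mx {R : realType} {m n : nat} (x : nat -> 'M[R]_(m, n)) (l : 'M[R]_(m, n)) :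
  (forall i j, x k i j @[k --> \oo] --> l i j) -> x k @[k --> \oo] --> l.
Proof.
move=> xl; apply/cvg_ballP => e e_gt0.
suff [K leK] : exists K, forall i j k, (K <= k)%N -> ball (l i j) e (x k i j).
  by exists K => // k /= leKk; split=> // i j; apply: leK.
have /choice[K HK] (ij : 'I_m * 'I_n) :
    exists K, forall k, (K <= k)%N -> ball (l ij.1 ij.2) e (x k ij.1 ij.2).
  by have /cvg_ballP/(_ e e_gt0)[K _ leK] := xl ij.1 ij.2; exists K.
exists (\max_ij K ij)%N => i j k leKk.
by apply: (HK (i, j)); apply: leq_trans leKk; apply: leq_bigmax.
Qed.

Theorem corollary1 (R : realType) (N : nat) (W : 'M[R]_N)
    (W_ge0 : edge_weights W) (W_conn : connected_graph W)
    (alpha : nat -> R) (alpha_max : R)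
    (alpha_bnd : forall k : nat, 0 < alpha k <= alpha_max)
    (alpha_lim : alpha k @[k --> \oo] --> (0 : R))
    (alpha_sum : \sum_(0 <= k < n) alpha k @[n --> \oo] --> +oo) :
  reaches_consensus (fun k x => x - alpha k *: (laplacian W *m x)).
Proof.
(* Without nodes there are no entries to check. *)
case: N => [|N] in W W_ge0 W_conn *.
  move=> x _; exists 0; apply: cvg_mx => i; by have := ltn_ord i.
have alpha_ge0 k : 0 <= alpha k by case/andP: (alpha_bnd k) => /ltW.
have [p pS p_gt0] := positive_stationary W W_ge0 W_conn.
have p_ge0 i : 0 <= p i := ltW (p_gt0 i).
have [C C_gt0 leC] := poincare W p W_ge0 W_conn p_gt0.
move=> x xE; set P := \sum_i p i.
have P_gt0 : 0 < P by rewrite /P big_ord_recl ltr_pwDl ?sumr_ge0.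
have xEi k i : x k.+1 i 0 = x k i 0 - alpha k * \sum_j W i j * (x k i 0 - x k j 0).
  by rewrite xE -laplacian_mulmxE !mxE.
have mean_const k : \sum_i p i * x k i 0 = \sum_i p i * x 0%N i 0.
  elim: k => // k <-; under eq_bigr => i _ do rewrite xEi mulrBr.
  rewrite sumrB (_ : \sum_i p i * (alpha k * _) = 0) ?subr0 //.
  under eq_bigr => i _ do rewrite mulrCA.
  by rewrite -mulr_sumr stationary_sum_diff0 ?mulr0.
(* The conserved mean identifies the only possible consensus value. *)
set xbar := (\sum_i p i * x 0%N i 0) / P.
pose y k i := x k i 0 - xbar.
pose V k := \sum_i p i * y k i ^+ 2.
have yE k i : y k.+1 i = y k i - alpha k * \sum_j W i j * (y k i - y k j).
  rewrite /y xEi addrAC; congr (_ - _ * _); apply: eq_bigr => j _.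
  by rewrite opprB addrA subrK.
have y_mean0 k : \sum_i p i * y k i = 0.
  rewrite /y; under eq_bigr => i _ do rewrite mulrBr.
  by rewrite sumrB mean_const -mulr_suml mulrC divfK ?subrr // gt_eqF.
have V_ge0 k : 0 <= V k by apply: sumr_ge0 => i _; rewrite mulr_ge0 ?sqr_ge0.
set D := \sum_i \sum_j W i j.
have D_ge0 : 0 <= D by do 2!apply: sumr_ge0 => ? _.
have V_step k : V k.+1 <= V k - alpha k * (1 - alpha k * D) * dirichlet W p (y k).
  have -> : V k.+1 = V k
      - alpha k * (2 * \sum_i p i * y k i * (\sum_j W i j * (y k i - y k j)))
      + alpha k ^+ 2 * \sum_i p i * (\sum_j W i j * (y k i - y k j)) ^+ 2.
    rewrite /V !mulr_sumr -sumrB -big_split /=.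
    by apply: eq_bigr => i _; rewrite yE; ring.
  rewrite dirichlet_laplacian //.
  have := ler_wpM2l (sqr_ge0 (alpha k)) (sqr_laplacian_le W p W_ge0 p_ge0 (y k)).
  rewrite -/D; lra.
(* Below this threshold 1 - alpha_k D >= 1/2; [D + 1] replaces [D], which may be zero. *)
have [K _ leK] : \forall k \near \oo, alpha k < (2 * (D + 1))^-1.
  by apply: (cvgr_lt 0) => //; rewrite invr_gt0 mulr_gt0 // ltr_wpDl.
have V_descent k : (K <= k)%N -> V k.+1 <= V k - (2 * C)^-1 * alpha k * V k.
  move=> /leK/=; rewrite -[_^-1]mul1r ltr_pdivlMr ?mulr_gt0 ?ltr_wpDl // => aD.
  apply: le_trans (V_step k) _; rewrite lerD2l lerN2.
  have half : 1 / 2 <= 1 - alpha k * D by have := alpha_ge0 k; lra.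
  have E_ge0 := dirichlet_ge0 W p W_ge0 p_ge0 (y k).
  have le_half : alpha k * (1 / 2) * dirichlet W p (y k)
      <= alpha k * (1 - alpha k * D) * dirichlet W p (y k).
    by rewrite ler_wpM2r // ler_wpM2l.
  apply: le_trans le_half; rewrite mulrAC -mulrA -[X in _ <= X]mulrA invfM.
  have : C^-1 * V k <= dirichlet W p (y k) by rewrite ler_pdivrMl ?leC.
  have a2_ge0 : 0 <= alpha k / 2 by rewrite divr_ge0.
  move/(ler_wpM2l a2_ge0); lra.
have c_gt0 : 0 < (2 * C)^-1 by rewrite invr_gt0 mulr_gt0.
have V_cvg := cvg0_of_descent _ _ _ _ c_gt0 alpha_ge0 V_ge0 V_descent alpha_sum.
exists xbar; apply: cvg_mx => i j; rewrite ord1 !mxE mulr1.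
apply/cvgrPdist_lt => e e_gt0.
(* The term p_i y_i^2 alone is at most [V k], so this bound gives |y_i| < e. *)
have : \forall k \near \oo, V k < p i * e ^+ 2.
  by apply: (cvgr_lt 0) => //; rewrite mulr_gt0 ?exprn_gt0.
apply: filterS => k Vk.
rewrite distrC -(@ltr_pXn2r _ 2) ?nnegrE ?normr_ge0 ?ltW // -normrX ger0_norm ?sqr_ge0 //.
rewrite -(ltr_pM2l (p_gt0 i)); apply: le_lt_trans Vk.
rewrite /V (bigD1 i) //= lerDl sumr_ge0 // => l _.
by rewrite mulr_ge0 ?sqr_ge0.
Qed.
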